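(* Let $f\in\mathrm{Diff}^{\infty}_0([0,1])$, and let $E_1(f)=\emptyset$. (A) If $E_2(f)\ne\emptyset$, then $\Gamma_n(f)\asymp n^2$ as $n\to\infty$. (B) If $E_2(f)=\emptyset$ and $E_\infty(f)\ne\emptyset$, then $\Gamma_n(f)=o(n^2)$ as $n\to\infty$. (C) If $k\ge 3$ is an integer, $E_s(f)=\emptyset$ for $1<s<k$, $E_\infty(f)=\emptyset$, and $E_k(f)\ne\emptyset$, then $\Gamma_n(f)\asymp n^{k/(k-1)}$ as $n\to\infty$.
   Context: $\mathrm{Diff}^{\infty}_0([0,1])$ is the group of all $C^\infty$-smooth diffeomorphisms of $[0,1]$ onto itself fixing the endpoints $0$ and $1$. For such $f$, $f^n$ ($n\ge1$) is the $n$-th iterate of $f$ and $f^{-n}$ is the $n$-th iterate of $f^{-1}$. The growth sequence of $f$ is $$\Gamma_n(f)=\max\bigl(\max_{x\in[0,1]}|(f^n)'(x)|,\ \max_{x\in[0,1]}|(f^{-n})'(x)|\bigr),\qquad n\ge1.$$ $E(f)=\{x\in[0,1]:f(x)=x\}$ is the set of fixed points of $f$, and $E_1(f)=\{x\in E(f): f'(x)\ne1\}$; $E_k(f)=\{x\in E(f): f'(x)=1,\ f''(x)=\dots=f^{(k-1)}(x)=0,\ f^{(k)}(x)\neq0\}$ for integers $k\ge2$; $E_\infty(f)=\{x\in E(f): f'(x)=1,\ f^{(j)}(x)=0 \text{ for all } j\ge2\}$. The notation $a(n)\asymp b(n)$, $n\to\infty$, means that $0<c\le a(n)/b(n)\le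 C<\infty$ for some constants $c,C$ independent of $n$. *)

(* Defs.v *)
From HB Require Import structures.
From mathcomp Require Import all_boot all_order all_algebra.
From mathcomp Require Import all_classical reals topology normedtype landau.
From mathcomp Require Import sequences exp.

Set Implicit Arguments.
Unset Strict Implicit.
Unset Printing Implicit Defensive.

Import Order.TTheory GRing.Theory Num.Theory.
Import numFieldNormedType.Exports.

Local Open Scope classical_set_scope.
Local Open Scope ring_scope.

(* A map [0,1] -> [0,1] is represented by a function R -> R whose values
   outside [0,1] are irrelevant: every notion below depends only on the
   restriction to [0,1]. *)

Section Derivatives.
Context {R : realType}.
Implicit Types (f : R -> R) (x : R).

(* The increment is restricted to y in [0,1], y != x: two-sided derivative
   in the interior, one-sided derivative at 0 and at 1. *)
Definition derivable01 f x : Prop :=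
  cvg ((f y - f x) / (y - x) @[y --> within `[0, 1] x^']).

Definition der01 f x : R :=
  lim ((f y - f x) / (y - x) @[y --> within `[0, 1] x^']).

Definition der01n (k : nat) f : R -> R := iter k der01 f.

Definition smooth01 f : Prop :=
  forall (k : nat) x, 0 <= x <= 1 -> derivable01 (der01n k f) x.

End Derivatives.

Section Diffeomorphisms.
Context {R : realType}.
Implicit Types (f : R -> R) (n k : nat).

Definition inv01 f : R -> R := pinv (`[0, 1] : set R) f.

Definition Diff01 f : Prop :=
  [/\ set_bij `[0, 1] `[0, 1] f, f 0 = 0, f 1 = 1,
      smooth01 f & smooth01 (inv01 f)].

(* For f in Diff01 the supremum is over the values of a continuous function
   on a compact set, hence it is a maximum. *)
Definition maxder01 f : R := sup [set `|der01 f x| | x in `[0, 1]].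

Definition Growth f n : R :=
  Num.max (maxder01 (iter n f)) (maxder01 (iter n (inv01 f))).

Definition Efix f : set R := [set x | 0 <= x <= 1 /\ f x = x].

Definition E1 f : set R := [set x | Efix f x /\ der01 f x <> 1].

(* Meaningful for k >= 2 only; E_1 is E1 above. *)
Definition Ek k f : set R :=
  [set x | [/\ Efix f x, der01 f x = 1,
               forall j, (2 <= j < k)%N -> der01n j f x = 0
             & der01n k f x <> 0]].

Definition Einf f : set R :=
  [set x | [/\ Efix f x, der01 f x = 1
             & forall j, (2 <= j)%N -> der01n j f x = 0]].

Definition asymp (a b : nat -> R) : Prop :=
  exists c C : R, 0 < c /\
    forall n, (1 <= n)%N -> c <= a n / b n /\ a n / b n <= C.

End Diffeomorphisms.

(* Main.v *)
Require Import Defs.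
From HB Require Import structures.
From mathcomp Require Import all_boot all_order all_algebra.
From mathcomp Require Import all_classical reals topology normedtype landau.
From mathcomp Require Import sequences exp derive.
From mathcomp Require Import ring lra.

Set Implicit Arguments.
Unset Strict Implicit.
Unset Printing Implicit Defensive.

Import Order.TTheory GRing.Theory Num.Theory.
Import numFieldNormedType.Exports.

Local Open Scope classical_set_scope.
Local Open Scope ring_scope.

(* Write g x = |f x - x| (the gap at x).  Along an orbit the intervals between consecutive
   points are disjoint, so bounded distortion gives (f^n)'(x) = g (f^n x) / g x up
   to a factor independent of x and n; the growth sequence is therefore governed by
   how much g can vary along n steps.  Upper bounds come from |f' - 1| <= A g^al:
   then g^(-al) >= 1 moves by a bounded amount at each step, so it changes at most
   by a factor O(n), and g by a factor O(n^(1/al)).  Since f' = 1 at the zeros of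
   f - id, one may always take al = 1/2; if f'' vanishes there too, the constant
   becomes arbitrarily small near the fixed points, which gives o(n^2); if all fixed
   points have finite order at least k, Taylor expansion and compactness give
   al = (k-1)/k.  For the lower bound, an orbit of f or of its inverse converging to a
   point p of order k has |x_n - p| = O(n^(-1/(k-1))), hence g x_n = O(n^(-k/(k-1))). *)

(** * Differential calculus relative to [0,1] *)

Section OneSidedCalculus.
Context {R : realType}.
Implicit Types (f g h : R -> R) (x y l : R).

(** Differentiability in multiplied-out form: no division, and [y = x] needs no exclusion. *)
Definition has_der01 h x l : Prop :=
  forall e, 0 < e -> exists2 r, 0 < r & forall y, 0 <= y <= 1 ->
    `|y - x| < r -> `|h y - h x - l * (y - x)| <= e * `|y - x|.

Lemma within01_dnbhsP x (P : set R) :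
  (within `[0, 1] x^') P <->
  exists2 r, 0 < r & forall y, 0 <= y <= 1 -> y != x -> `|y - x| < r -> P y.
Proof.
rewrite /within /dnbhs /within /=; split.
  move=> /nbhs_ballP[r /= r0 H]; exists r => // y y01 yx yr.
  by apply: H => //; rewrite /ball /= distrC.
move=> [r r0 H]; apply/nbhs_ballP; exists r => //= y; rewrite /ball /= distrC => yr yx.
by rewrite in_itv /= => y01; apply: H.
Qed.

(** A step of length [Num.min (r / 2) 2^-1] towards the farther endpoint stays in [0,1]. Properness
    of the filter is what makes these one-sided limits unique. *)
Lemma within01_dnbhs_proper x : 0 <= x <= 1 ->
  ProperFilter (within `[0, 1] x^').
Proof.
move=> /andP[x0 x1]; apply: Build_ProperFilter_ex => P /within01_dnbhsP[r r0 H].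
have [xh|xh] := leP x (2^-1).
  exists (x + Num.min (r / 2) (2^-1)).
  have /andP[m0 m1] : 0 < Num.min (r / 2) (2^-1) <= 2^-1.
    by rewrite lt_min ge_min lexx orbT andbT; apply/andP; split; lra.
  have mr : Num.min (r / 2) (2^-1) <= r / 2 by rewrite ge_min lexx.
  apply: H; [lra|lra|]; rewrite addrC addKr gtr0_norm//; lra.
exists (x - Num.min (r / 2) (2^-1)).
have /andP[m0 m1] : 0 < Num.min (r / 2) (2^-1) <= 2^-1.
  by rewrite lt_min ge_min lexx orbT andbT; apply/andP; split; lra.
have mr : Num.min (r / 2) (2^-1) <= r / 2 by rewrite ge_min lexx.
apply: H; [lra|lra|]; rewrite addrC addKr normrN gtr0_norm//; lra.
Qed.

Lemma has_der01_cvg h x l : has_der01 h x l <->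
  (h y - h x) / (y - x) @[y --> within `[0, 1] x^'] --> l.
Proof.
split=> [H|/cvgrPdist_le H].
  apply/cvgrPdist_le => /= e e0; have [r r0 Hr] := H e e0.
  apply/within01_dnbhsP; exists r => // y y01 yx yr.
  have yx0 : y - x != 0 by rewrite subr_eq0.
  rewrite distrC -(ler_pM2r (x := `|y - x|)) ?normr_gt0// -normrM.
  by rewrite mulrBl divfK// Hr.
move=> e e0; have /within01_dnbhsP[r r0 Hr] := H e e0.
exists r => // y y01 yr.
have [->|yx] := eqVneq y x; first by rewrite !subrr mulr0 subr0 normr0 mulr0.
have yx0 : y - x != 0 by rewrite subr_eq0.
move: (Hr y y01 yx yr).
by rewrite distrC -(ler_pM2r (x := `|y - x|)) ?normr_gt0// -normrM mulrBl divfK.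
Qed.

Lemma derivable01_has h x : derivable01 h x -> has_der01 h x (der01 h x).
Proof. by move=> H; apply/has_der01_cvg. Qed.

Lemma has_der01_der h x l : 0 <= x <= 1 -> has_der01 h x l -> der01 h x = l.
Proof.
move=> /within01_dnbhs_proper ? /has_der01_cvg H.
exact: (cvg_lim (@Rhausdorff R)).
Qed.

Lemma has_der01_cont h x l : has_der01 h x l ->
  forall e, 0 < e -> exists2 r, 0 < r & forall y, 0 <= y <= 1 ->
    `|y - x| < r -> `|h y - h x| < e.
Proof.
move=> H e e0; have [r r0 Hr] := H 1 ltr01.
have l1 : 0 < `|l| + 1 by rewrite ltr_wpDl.
exists (Num.min r (e / (`|l| + 1))) => [|y y01]; first by rewrite lt_min r0 divr_gt0.
rewrite lt_min => /andP[yr ye]; have := Hr y y01 yr; rewrite mul1r => Hy.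
rewrite -[_ - _](subrK (l * (y - x))); apply: (le_lt_trans (ler_normD _ _)).
rewrite ltr_pdivlMr// mulrDr mulr1 mulrC in ye.
by rewrite normrM; apply: le_lt_trans ye; rewrite addrC lerD2l.
Qed.

Lemma has_der01_continuous h (d : R -> R) :
  (forall x, 0 <= x <= 1 -> has_der01 h x (d x)) ->
  forall a b, 0 <= a -> b <= 1 -> {within `[a, b], continuous h}.
Proof.
move=> H a b a0 b1; apply/subspace_continuousP => x /=; rewrite in_itv /= => xab.
have x01 : 0 <= x <= 1 by lra.
apply/cvgrPdist_lt => /= e e0; have [r r0 Hr] := has_der01_cont (H x x01) e0.
rewrite /within /=; apply/nbhs_ballP; exists r => //= y.
rewrite /ball /= distrC => yr; rewrite in_itv /= => yab; rewrite distrC; apply: Hr => //.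
lra.
Qed.

Lemma has_der01_is_derive h x l : 0 < x < 1 -> has_der01 h x l ->
  is_derive x 1 h l.
Proof.
move=> x01 H.
have C : h0^-1 *: ((h \o shift x) (h0 *: 1) - h x) @[h0 --> 0^'] --> l.
  apply/cvgrPdist_le => /= e e0; have [r r0 Hr] := H e e0.
  apply/nbhs_ballP; exists (Num.min r (Num.min x (1 - x))) => /=.
    by rewrite !lt_min r0/=; apply/andP; split; lra.
  move=> y; rewrite /ball /= sub0r normrN !lt_min => /and3P[yr yx yx1] y0.
  have y1 : 0 <= y + x <= 1.
    by move: yx yx1; rewrite !ltr_norml => /andP[? ?] /andP[? ?]; lra.
  have := Hr _ y1; rewrite addrK => /(_ yr).
  rewrite -(ler_pM2l (x := `|y^-1|)) ?normr_gt0 ?invr_eq0// -normrM.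
  rewrite mulrCA -normrM mulVf// normr1 mulr1 /GRing.scale /= mulr1 distrC.
  by rewrite mulrBr mulrCA mulVf// mulr1.
by split; [apply/cvg_ex; exists l|exact: (cvg_lim (@Rhausdorff R))].
Qed.

Lemma MVT01 h (d : R -> R) :
  (forall x, 0 <= x <= 1 -> has_der01 h x (d x)) ->
  forall x y, 0 <= x <= 1 -> 0 <= y <= 1 ->
  exists z, [/\ 0 <= z <= 1, Num.min x y <= z <= Num.max x y
              & h y - h x = d z * (y - x)].
Proof.
move=> H.
have K x y : 0 <= x -> x < y -> y <= 1 ->
    exists2 z, x < z < y & h y - h x = d z * (y - x).
  move=> x0 xy y1.
  have Hd z : z \in `]x, y[ -> is_derive z 1 h (d z).
    rewrite in_itv /= => zxy; apply: has_der01_is_derive; first lra.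
    by apply: H; lra.
  have [z zxy E] := MVT xy Hd (has_der01_continuous H x0 y1).
  by exists z => //; move: zxy; rewrite in_itv.
move=> x y /andP[x0 x1] /andP[y0 y1].
have [xy|yx|->] := ltgtP x y.
- have [z /andP[xz zy] E] := K x y x0 xy y1.
  by exists z; split=> //; lra.
- have [z /andP[xz zy] E] := K y x y0 yx x1.
  exists z; split=> //; [lra|lra|].
  by rewrite -[LHS]opprB E -mulrN opprB.
- by exists y; split; [lra|rewrite !lexx|rewrite !subrr mulr0].
Qed.

Lemma has_der01_comp f g x l l' : (forall y, 0 <= y <= 1 -> 0 <= g y <= 1) ->
  has_der01 g x l -> has_der01 f (g x) l' -> has_der01 (f \o g) x (l' * l).
Proof.
move=> g01 Hg Hf e e0.
have l1 : 0 < `|l| + 1 by rewrite ltr_wpDl.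
have l'1 : 0 < `|l'| + 1 by rewrite ltr_wpDl.
have [r r0 Hr] := Hf (e / 2 / (`|l| + 1)) ltac:(by rewrite !divr_gt0).
have [r1 r10 Hr1] := has_der01_cont Hg r0.
have [r2 r20 Hr2] := Hg (e / 2 / (`|l'| + 1)) ltac:(by rewrite !divr_gt0).
have [r3 r30 Hr3] := Hg 1 ltr01.
exists (Num.min r1 (Num.min r2 r3)) => [|y y01]; first by rewrite !lt_min r10 r20.
rewrite !lt_min => /and3P[/(Hr1 _ y01)/(Hr _ (g01 _ y01)) A /(Hr2 _ y01) B /(Hr3 _ y01) C].
have D : `|g y - g x| <= (`|l| + 1) * `|y - x|.
  rewrite -[_ - _](subrK (l * (y - x))); apply: (le_trans (ler_normD _ _)).
  by rewrite mulrDl mul1r addrC normrM lerD2l; rewrite mul1r in C.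
have -> : (f \o g) y - (f \o g) x - l' * l * (y - x) =
  (f (g y) - f (g x) - l' * (g y - g x)) + l' * (g y - g x - l * (y - x)).
  by rewrite /=; ring.
apply: (le_trans (ler_normD _ _)); rewrite normrM.
have A' : `|f (g y) - f (g x) - l' * (g y - g x)| <= e / 2 * `|y - x|.
  apply: (le_trans A); apply: le_trans (ler_wpM2l _ D) _.
    by rewrite !divr_ge0 ?ltW.
  by rewrite mulrA divfK ?gt_eqF.
have B' : `|l'| * `|g y - g x - l * (y - x)| <= e / 2 * `|y - x|.
  apply: (@le_trans _ _ ((`|l'| + 1) * (e / 2 / (`|l'| + 1) * `|y - x|))).
    by apply: ler_pM => //; rewrite lerDl.
  by rewrite mulrA mulrCA divff ?gt_eqF// mulr1.
by apply: (le_trans (lerD A' B')); rewrite -mulrDl -splitr.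
Qed.

(** Compactness of [0,1], as a near-covering statement against the filter at [+oo]: each local
    condition holds for all large [C], so one [C] serves every point. It turns local estimates into
    uniform ones. *)
Lemma locally_bounded01 (P : R -> R -> Prop) :
  (forall x, 0 <= x <= 1 -> exists2 r, 0 < r & exists C0, forall y C,
     0 <= y <= 1 -> `|y - x| < r -> C0 <= C -> P C y) ->
  exists2 C, 0 < C & forall y, 0 <= y <= 1 -> P C y.
Proof.
move=> H.
have /compact_near_coveringP/near_covering_withinP K := @segment_compact R 0 1.
have := K R +oo P _ _; case=> [x|C0 [_ HC]].
  rewrite /= in_itv /= => /H[r r0 [C0 HC]].
  exists (ball x r, [set C | C0 <= C]).
    split; first by apply/nbhs_ballP; exists r.
    by rewrite /=; exact: (nbhs_pinfty_ge (num_real C0)).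
  move=> [y C] /= [yr CC]; rewrite in_itv /= => y01.
  by apply: HC => //; move: yr; rewrite /ball /= distrC.
exists (Num.max C0 0 + 1); first by rewrite ltr_wpDl// le_max lexx orbT.
move=> y y01; apply: (HC (Num.max C0 0 + 1)); last by rewrite /= in_itv.
have : C0 <= Num.max C0 0 by rewrite le_max lexx.
lra.
Qed.

Lemma maxder01_le h K : (forall x, 0 <= x <= 1 -> `|der01 h x| <= K) ->
  maxder01 h <= K.
Proof.
move=> H; apply: ge_sup.
  by exists `|der01 h 0|; exists 0 => //=; rewrite in_itv/= lexx ler01.
by move=> _ [x /= + <-]; rewrite in_itv/= => /H.
Qed.

Lemma maxder01_ge h K x : (forall y, 0 <= y <= 1 -> `|der01 h y| <= K) ->
  0 <= x <= 1 -> `|der01 h x| <= maxder01 h.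
Proof.
move=> H x01; apply: ub_le_sup; last by exists x => //=; rewrite in_itv.
by exists K => _ [y /= + <-]; rewrite in_itv/= => /H.
Qed.

Lemma IVT01 h (d : R -> R) : (forall x, 0 <= x <= 1 -> has_der01 h x (d x)) ->
  forall x y, 0 <= x <= 1 -> 0 <= y <= 1 -> h x <= 0 -> 0 <= h y ->
  exists2 z, Num.min x y <= z <= Num.max x y & h z = 0.
Proof.
move=> H x y /andP[x0 x1] /andP[y0 y1] hx hy.
have Hc a b : 0 <= a -> b <= 1 -> {within `[a, b], continuous h}.
  by move=> a0 b1; exact: (has_der01_continuous H).
have [xy|yx] := leP x y.
  have [|z] := IVT xy (Hc _ _ x0 y1) (v := 0).
    by rewrite ge_min hx le_max hy orbT.
  by rewrite in_itv /= => zI hz; exists z.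
have [|z] := IVT (ltW yx) (Hc _ _ y0 x1) (v := 0).
  by rewrite ge_min hx le_max hy orbT.
by rewrite in_itv /= => zI hz; exists z.
Qed.

Lemma has_der01_id x : has_der01 id x 1.
Proof.
move=> e e0; exists 1 => // y _ _ /=.
by rewrite mul1r subrr normr0 mulr_ge0// ltW.
Qed.

Lemma has_der01_cst c x : has_der01 (fun=> c) x 0.
Proof.
move=> e e0; exists 1 => // y _ _ /=.
by rewrite mul0r !subrr normr0 mulr_ge0// ltW.
Qed.

Lemma has_der01N h x l : has_der01 h x l -> has_der01 (fun y => - h y) x (- l).
Proof.
move=> H e e0; have [r r0 Hr] := H e e0; exists r => // y y01 yr.
by rewrite mulNr -!opprD normrN Hr.
Qed.

Lemma has_der01B h g x l k : has_der01 h x l -> has_der01 g x k ->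
  has_der01 (fun y => h y - g y) x (l - k).
Proof.
move=> Hh Hg e e0; have e2 : 0 < e / 2 by rewrite divr_gt0.
have [r r0 Hr] := Hh _ e2; have [s s0 Hs] := Hg _ e2.
exists (Num.min r s) => [|y y01]; first by rewrite lt_min r0.
rewrite lt_min => /andP[/(Hr _ y01) A /(Hs _ y01) B].
rewrite (_ : _ - _ = (h y - h x - l * (y - x)) - (g y - g x - k * (y - x))); last by ring.
apply: (le_trans (ler_normB _ _)); apply: (le_trans (lerD A B)).
by rewrite -mulrDl -splitr.
Qed.

Lemma is_derive_has_der01 h x l : is_derive x 1 h l -> has_der01 h x l.
Proof.
move=> [/cvg_ex[k] H D] e e0; have {D}D : k = l.
  by rewrite -D; apply/esym/(cvg_lim (@Rhausdorff R)).
rewrite {}D in H; move/cvgrPdist_le: H => /(_ e e0)/nbhs_ballP[r /= r0 Hr].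
exists r => // y y01 yr; have [->|yx] := eqVneq y x.
  by rewrite !subrr mulr0 subr0 normr0 mulr0.
have yx0 : y - x != 0 by rewrite subr_eq0.
have := Hr (y - x); rewrite /ball /= sub0r normrN => /(_ yr yx0).
rewrite -(ler_pM2r (x := `|y - x|)) ?normr_gt0// -normrM.
rewrite /GRing.scale /= mulr1 subrK.
rewrite (_ : (l - _) * (y - x) = - (h y - h x - l * (y - x))) ?normrN//.
by field.
Qed.

Lemma has_der01_monomial p c n x :
  has_der01 (fun y => c / n.+1%:R * (y - p) ^+ n.+1) x (c * (x - p) ^+ n).
Proof.
apply: is_derive_has_der01.
have D : is_derive x 1 (id - cst p) 1 by apply: is_derive_eq; rewrite subr0.
have -> : (fun y => c / n.+1%:R * (y - p) ^+ n.+1) =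
    (c / n.+1%:R) \*: (id - cst p) ^+ n.+1.
  by apply/funext => y; rewrite /= fctE.
apply: is_derive_eq.
rewrite /GRing.scale /= mulr1; field.
by rewrite nat1r pnatr_eq0.
Qed.

(* |h'| stays above |h' x|/2 up to distance |h' x|/(2e) from x, and h has no
   zero there since h' vanishes at the zeros of h. *)
Lemma sqr_der_le h (h' : R -> R) e r x :
  (forall y, 0 <= y <= 1 -> has_der01 h y (h' y)) -> h 0 = 0 -> h 1 = 0 ->
  (forall y, 0 <= y <= 1 -> h y = 0 -> h' y = 0) -> 0 < e -> 0 <= x <= 1 ->
  (forall y, 0 <= y <= 1 -> `|y - x| <= r -> `|h' y - h' x| <= e * `|y - x|) ->
  `|h' x| <= e * r -> h' x ^+ 2 <= 4 * e * `|h x|.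
Proof.
move=> + h0 h1 + e0 x01.
wlog hx : h h' h0 h1 / 0 <= h x => [W H Hz Hl Hr|H Hz Hl Hr].
  have [hx|hx] := leP 0 (h x); first exact: W.
  rewrite -[h' x ^+ 2]sqrrN -normrN.
  apply: (W (fun y => - h y) (fun y => - h' y)).
  - by rewrite h0 oppr0.
  - by rewrite h1 oppr0.
  - by rewrite oppr_ge0 ltW.
  - by move=> y y01; exact/has_der01N/H.
  - by move=> y y01 /eqP; rewrite oppr_eq0 => /eqP/(Hz _ y01)->; rewrite oppr0.
  - by move=> y y01 yr; rewrite -opprD normrN Hl.
  - by rewrite normrN.
have [q0|q0] := eqVneq (h' x) 0.
  by rewrite q0 expr0n /= !mulr_ge0// ltW.
set q := h' x in Hl Hr q0 *.
have qe0 : 0 < `|q| / e by rewrite divr_gt0// normr_gt0.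
have qr : `|q| / e <= r by rewrite ler_pdivrMr// mulrC.
have nz z : 0 <= z <= 1 -> `|z - x| < `|q| / e -> h z != 0.
  move=> z01 zx; apply/eqP => hz.
  have := Hl z z01 (ltW (lt_le_trans zx qr)); rewrite (Hz _ z01 hz) sub0r normrN.
  by move: zx; rewrite ltr_pdivlMr// mulrC => zx; rewrite leNgt zx.
(* Going from [x] in the direction where [h] decreases, over half the zero-free distance, [h] stays
   nonnegative yet drops by at least [q ^+ 2 / (4 * e)]; this bounds [h x] from below. *)
pose y := x - q / (2 * e).
have yx : `|y - x| = `|q| / e / 2.
  rewrite /y addrC addKr normrN normrM normfV (gtr0_norm (x := 2 * e)) ?mulr_gt0//.
  by rewrite invfM mulrA mulrAC.
(* The endpoints are zeros of [h], so they are at distance at least [|q| / e] from [x], beyond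
   [y]. *)
have y01 : 0 <= y <= 1.
  apply/andP; split; rewrite leNgt; apply/negP => yI.
    have := nz 0; rewrite h0 eqxx lexx ler01 sub0r normrN => /(_ isT) H0.
    suff : false by []. apply: H0; case/andP: x01 => x0 x1.
    by have := ler_norm (x - y); rewrite distrC yx (ger0_norm x0); lra.
  have := nz 1; rewrite h1 eqxx lexx ler01 => /(_ isT) H0.
  suff : false by []. apply: H0; case/andP: x01 => x0 x1.
  by have := ler_norm (y - x); rewrite yx (ger0_norm (x := 1 - x)) ?subr_ge0//; lra.
have near z : Num.min x y <= z <= Num.max x y -> `|z - x| <= `|q| / e / 2.
  rewrite -yx; case: (leP x y) => ? ?; [rewrite !ger0_norm|rewrite !ler0_norm]; lra.
have I01 z : Num.min x y <= z <= Num.max x y -> 0 <= z <= 1.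
  by case: (leP x y) => ? ?; lra.
have hy : 0 <= h y.
  rewrite leNgt; apply/negP => hy.
  have [z zI hz] := IVT01 H y01 x01 (ltW hy) hx.
  rewrite minC maxC in zI.
  have := nz z (I01 z zI); rewrite hz eqxx => F.
  suff : false by []. apply: F; apply: le_lt_trans (near z zI) _; lra.
have [z [z01 zI E]] := MVT01 H y01 x01.
rewrite minC maxC in zI.
have zn := near z zI.
have : `|h' z - q| <= `|q| / 2.
  have zr : `|z - x| <= r by apply: le_trans zn _; lra.
  apply: (le_trans (Hl z z01 zr)); apply: le_trans (ler_wpM2l (ltW e0) zn) _.
  by rewrite mulrA mulrCA divff ?gt_eqF// mulr1.
rewrite ler_distl => /andP[A B].
have hz : q ^+ 2 / 2 <= h' z * q.
  have [qp|qn|/eqP] := ltgtP 0 q; last by rewrite eq_sym (negPf q0).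
    rewrite (gtr0_norm qp) in A B; nra.
  rewrite (ltr0_norm qn) in A B; nra.
have : q ^+ 2 / 2 <= h x * (2 * e).
  apply: (le_trans hz).
  have -> : h' z * q = (h x - h y) * (2 * e).
    rewrite E /y; field; lra.
  by rewrite ler_wpM2r ?mulr_ge0 ?(ltW e0)// gerBl.
by rewrite (ger0_norm hx); nra.
Qed.

(** Induction on [n] through the shifted family: the mean value theorem is applied to [H 0] minus
    its leading monomial, whose derivative is the remainder of [H 1]. A family of successive
    derivatives, rather than [der01n], lets the result apply to [f - id]. *)
Lemma taylor01 n (H : nat -> R -> R) p : 0 <= p <= 1 ->
  (forall j x, 0 <= x <= 1 -> has_der01 (H j) x (H j.+1 x)) ->
  (forall j, (j < n)%N -> H j p = 0) ->
  forall e, 0 < e -> exists2 r, 0 < r & forall x, 0 <= x <= 1 -> `|x - p| < r ->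
    `|H 0%N x - H n p / n`!%:R * (x - p) ^+ n| <= e * `|x - p| ^+ n.
Proof.
move=> p01; elim: n H => [|n IH] H dH H0 e e0.
  have [r r0 Hr] := has_der01_cont (dH 0%N p p01) e0.
  exists r => // x x01 xr; rewrite fact0 divr1 !expr0 !mulr1.
  exact/ltW/Hr.
have [||r r0 Hr] := IH (fun j => H j.+1) _ _ e e0.
- by move=> j; exact: dH.
- by move=> j jn; exact: H0.
exists r => // x x01 xr.
set c := H n.+1 p / n`!%:R in Hr.
have Ec : H n.+1 p / (n.+1)`!%:R = c / n.+1%:R.
  by rewrite /c factS natrM invfM mulrA mulrAC.
rewrite Ec.
have D y : 0 <= y <= 1 -> has_der01
    (fun y => H 0%N y - c / n.+1%:R * (y - p) ^+ n.+1) y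
    (H 1%N y - c * (y - p) ^+ n).
  by move=> y01; apply: has_der01B; [exact: dH|exact: has_der01_monomial].
have [z [z01 zI]] := MVT01 D p01 x01.
rewrite subrr expr0n /= mulr0 subr0 H0// subr0 => ->.
have zp : `|z - p| <= `|x - p|.
  by move: zI; case: (leP p x) => ? ?; [rewrite !ger0_norm|rewrite !ler0_norm]; lra.
rewrite normrM exprSr mulrA ler_wpM2r//.
apply: (le_trans (Hr z z01 (le_lt_trans zp xr))).
by rewrite ler_wpM2l ?(ltW e0)// lerXn2r ?nnegrE.
Qed.

End OneSidedCalculus.

(** * Real powers and decay of recursive sequences *)

Section PowerLemmas.
Context {R : realType}.
Implicit Types (a b c al : R).

Lemma powRN_le_mul1D a b c al : 0 < a -> 0 < b -> 0 <= c -> 0 < al <= 1 ->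
  b <= a * (1 + c) -> a `^ (- al) <= b `^ (- al) * (1 + c).
Proof.
move=> a0 b0 c0 /andP[al0 al1] H.
have c1 : 1 <= 1 + c by rewrite lerDl.
have c1' : 0 < 1 + c by apply: lt_le_trans c1.
have : b `^ al <= a `^ al * (1 + c).
  apply: le_trans (_ : (a * (1 + c)) `^ al <= _).
    by apply: ge0_ler_powR; rewrite ?nnegrE ?mulr_ge0 // ltW.
  by rewrite powRM; [rewrite ler_wpM2l ?powR_ge0 ?ler1_powR|exact: ltW|exact: ltW].
move=> K; rewrite !powRN [leRHS]mulrC ler_pdivlMr ?powR_gt0//.
by rewrite ler_pdivrMl ?powR_gt0.
Qed.

Lemma le_mul_powRV a b c al : 0 < a -> 0 < b -> 0 <= c -> 0 < al ->
  a `^ (- al) <= b `^ (- al) * c -> b <= c `^ al^-1 * a.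
Proof.
move=> a0 b0 c0 al0; rewrite !powRN [leRHS]mulrC ler_pdivlMr ?powR_gt0//.
rewrite ler_pdivrMl ?powR_gt0// => H.
have K x : 0 < x -> x = (x `^ al) `^ al^-1.
  by move=> x0; rewrite -powRrM divff ?gt_eqF// powRr1// ltW.
rewrite [leLHS]K// [in leRHS](K a)// -powRM ?powR_ge0//.
by rewrite mulrC; apply: ge0_ler_powR; rewrite ?nnegrE ?mulr_ge0 ?powR_ge0 ?invr_ge0 // ltW.
Qed.

Lemma powR_half_sqr a : 0 <= a -> (a `^ 2^-1) ^+ 2 = a.
Proof. by move=> a0; rewrite powR12_sqrt// sqr_sqrtr. Qed.

Lemma powR_mulSn_le1 (a u : R) q : (0 < q)%N -> 0 <= a -> 0 <= u ->
  a * u ^+ q <= 1 -> a `^ (q.+1%:R / q%:R) * u ^+ q.+1 <= 1.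
Proof.
move=> q0 a0 u0 H.
have q0' : 0 < q%:R :> R by rewrite ltr0n.
have -> : u ^+ q.+1 = (u ^+ q) `^ (q.+1%:R / q%:R).
  rewrite -!powR_mulrn// -powRrM; congr (_ `^ _); field.
  by rewrite gt_eqF.
rewrite -powRM ?exprn_ge0//.
apply: le_trans (_ : 1 `^ (q.+1%:R / q%:R) <= 1); last by rewrite powR1.
by apply: ge0_ler_powR; rewrite ?nnegrE ?mulr_ge0 ?exprn_ge0// invr_ge0.
Qed.

(** Discrete counterpart of [u' = - c u^(q+1)], whose solutions satisfy [u^q <= 1 / (c n)]. *)
Lemma sequence_decay (u : nat -> R) c q : (0 < q)%N -> 0 < c ->
  (forall n, 0 < u n) -> (forall n, u n.+1 <= u n - c * u n ^+ q.+1) ->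
  forall n, c * n%:R * u n ^+ q <= 1.
Proof.
move=> q0 c0 u0 H; elim=> [|n IH]; first by rewrite mulr0 mul0r ler01.
set a := c * u n ^+ q.
have a0 : 0 < a by rewrite mulr_gt0// exprn_gt0.
have un : u n.+1 <= u n * (1 - a).
  by apply: (le_trans (H n)); rewrite /a mulrBr mulr1 mulrCA -exprS.
(* Positivity of the next term forces [a < 1], so [(1 - a) ^+ q <= 1 - a]; with [n a <= 1] the
   induction closes by [(n a + a) (1 - a) <= 1 - a ^+ 2]. *)
have a1 : 0 < 1 - a by rewrite -(pmulr_rgt0 _ (u0 n)); apply: lt_le_trans un.
have A : u n.+1 ^+ q <= u n ^+ q * (1 - a).
  apply: le_trans (_ : (u n * (1 - a)) ^+ q <= _).
    by apply: lerXn2r => //; rewrite nnegrE ?mulr_ge0 ?ltW.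
  rewrite exprMn ler_wpM2l ?exprn_ge0 ?(ltW (u0 n))//.
  rewrite -(prednK q0) exprS ler_piMr ?(ltW a1)// exprn_ile1 ?(ltW a1)//.
  by rewrite gerBl ltW.
have na : n%:R * a <= 1 by rewrite mulrA (mulrC n%:R).
apply: (@le_trans _ _ (c * n.+1%:R * (u n ^+ q * (1 - a)))).
  by rewrite ler_wpM2l// mulr_ge0// ltW.
rewrite -natr1 (_ : c * _ * _ = (n%:R + 1) * a * (1 - a)); first nra.
by rewrite /a; ring.
Qed.

Lemma natr_ratio_01 q : (0 < q)%N -> 0 < (q%:R / q.+1%:R : R) <= 1.
Proof.
by move=> q0; rewrite divr_gt0 ?ltr0n//= ler_pdivrMr ?ltr0n// mul1r ler_nat.
Qed.

Lemma natr_ratio_le k q : (0 < k <= q)%N ->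
  (k%:R / k.+1%:R : R) <= q%:R / q.+1%:R.
Proof.
move=> /andP[k0 kq]; rewrite ler_pdivrMr ?ltr0n// mulrAC ler_pdivlMr ?ltr0n//.
by rewrite -!natrM ler_nat !mulnS (mulnC q) leq_add2r.
Qed.

End PowerLemmas.

(** * The inverse map and uniform bounds on the derivative *)

Section ParabolicDiffeo.
Context {R : realType}.
Variable f : R -> R.
Hypothesis f_diff : Diff01 f.
Hypothesis f_parabolic : E1 f = set0.

Local Notation f' := (der01 f).

Lemma Diff01_01 x : 0 <= x <= 1 -> 0 <= f x <= 1.
Proof.
move=> x01; have [[F _ _] _ _ _ _] := f_diff.
by have := F x; rewrite /= !in_itv /=; apply.
Qed.
Let f01 := Diff01_01.

Lemma Diff01_der j x : 0 <= x <= 1 -> has_der01 (der01n j f) x (der01n j.+1 f x).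
Proof. by move=> x01; have [_ _ _ S _] := f_diff; exact/derivable01_has/S. Qed.

Let df x : 0 <= x <= 1 -> has_der01 f x (f' x).
Proof. exact: (Diff01_der 0). Qed.

Let f0 : f 0 = 0.
Proof. by case: f_diff. Qed.

Let f1 : f 1 = 1.
Proof. by case: f_diff. Qed.

Lemma inv01K x : 0 <= x <= 1 -> inv01 f (f x) = x.
Proof.
move=> x01; have [[_ I _] _ _ _ _] := f_diff.
by rewrite /inv01 (pinvKV _ I)// inE /= in_itv.
Qed.
Let invK := inv01K.

Lemma Kinv01 x : 0 <= x <= 1 -> f (inv01 f x) = x.
Proof.
move=> x01; have [[_ _ S] _ _ _ _] := f_diff.
have [|y y01 <-] := S x; first by rewrite /= in_itv.
by rewrite invK//; move: y01; rewrite /= in_itv.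
Qed.
Let Kinv := Kinv01.

Lemma inv01_01 x : 0 <= x <= 1 -> 0 <= inv01 f x <= 1.
Proof.
move=> x01; have [[_ _ S] _ _ _ _] := f_diff.
have [|y y01 <-] := S x; first by rewrite /= in_itv.
by move: y01; rewrite /= in_itv /= => y01; rewrite invK.
Qed.
Let inv_01 := inv01_01.

(** Chain rule for [inv01 f \o f], which is the identity on [0,1]. In particular [f'] never
    vanishes. *)
Lemma der01_inv01_mul x : 0 <= x <= 1 -> der01 (inv01 f) (f x) * f' x = 1.
Proof.
move=> x01; have [_ _ _ _ S] := f_diff.
have D := has_der01_comp f01 (df x01) (derivable01_has (S 0%N _ (f01 x01))).
rewrite -(has_der01_der x01 D); apply: has_der01_der => // e e0.
exists 1 => // y y01 _ /=.
by rewrite !invK// mul1r subrr normr0 mulr_ge0// ltW.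
Qed.

Let dinv x : 0 <= x <= 1 -> has_der01 (inv01 f) (f x) (f' x)^-1.
Proof.
move=> x01; have [_ _ _ _ S] := f_diff.
have E := der01_inv01_mul x01.
have -> : (f' x)^-1 = der01 (inv01 f) (f x).
  apply: (mulIf (x := f' x)).
    by apply: contra_eqN E => /eqP->; rewrite mulr0 eq_sym oner_eq0.
  rewrite E mulVf//.
  by apply: contra_eqN E => /eqP->; rewrite mulr0 eq_sym oner_eq0.
exact: (derivable01_has (S 0%N _ (f01 x01))).
Qed.

Let f'_fix x : 0 <= x <= 1 -> f x = x -> f' x = 1.
Proof.
move=> x01 fx; apply: contrapT => nE.
by have : E1 f x by []; rewrite f_parabolic.
Qed.

Let zero01 : 0 <= (0 : R) <= 1.
Proof. by rewrite lexx ler01. Qed.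

(** [f'] is continuous without zeros and equals 1 at the fixed point 0, so it cannot change sign. *)
Let f'_gt0 x : 0 <= x <= 1 -> 0 < f' x.
Proof.
move=> x01; rewrite ltNge; apply/negP => fx.
have f'0 : 0 <= f' 0 by rewrite (f'_fix zero01 f0).
have [z zI E] := IVT01 (@Diff01_der 1) x01 zero01 fx f'0.
have zz : 0 <= z <= 1.
  by move: zI; case/andP: x01 => x0 x1; rewrite (min_r x0) (max_l x0); lra.
by have := der01_inv01_mul zz; rewrite (E : f' z = 0) mulr0 => /eqP; rewrite eq_sym oner_eq0.
Qed.

Lemma der01_ge : exists2 m, 0 < m & forall x, 0 <= x <= 1 -> m <= f' x.
Proof.
have [|C C0 HC] := @locally_bounded01 R (fun C x => 1 <= C * f' x).
  move=> x x01; have fx := f'_gt0 x01.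
  have fx2 : 0 < f' x / 2 by rewrite divr_gt0.
  have [r r0 Hr] := has_der01_cont (Diff01_der 1 x01) fx2.
  exists r => //; exists (2 / f' x) => y C y01 /(Hr y y01).
  rewrite ltr_distl => /andP[A _] HC.
  have E : 2 / f' x * (f' x / 2) = 1 by field; rewrite gt_eqF.
  rewrite -[leLHS]E; apply: ler_pM => //; rewrite ?divr_ge0 ?(ltW fx)//.
  by apply: ltW; apply: le_lt_trans A; rewrite /= [X in _ <= X - _](splitr (f' x)) addrK.
by exists C^-1 => [|x x01]; rewrite ?invr_gt0// -[C^-1]mul1r ler_pdivrMr// mulrC HC.
Qed.

Lemma der01_lipschitz : exists2 M, 0 < M & forall x y,
  0 <= x <= 1 -> 0 <= y <= 1 -> `|f' x - f' y| <= M * `|x - y|.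
Proof.
have [|C C0 HC] := @locally_bounded01 R (fun C x => `|der01n 2 f x| <= C).
  move=> x x01; have [r r0 Hr] := has_der01_cont (Diff01_der 2 x01) ltr01.
  exists r => //; exists (`|der01n 2 f x| + 1) => y C y01 /(Hr y y01) A; apply: le_trans.
  by rewrite -lerBlDl; apply: le_trans (lerB_dist _ _) (ltW A).
exists C => // x y x01 y01.
have [z [z01' _ ->]] := MVT01 (Diff01_der 1) y01 x01.
by rewrite normrM ler_wpM2r// HC.
Qed.

(** * Gaps along an orbit *)

Variables (m M : R).
Hypothesis m_gt0 : 0 < m.
Hypothesis f'_ge : forall x, 0 <= x <= 1 -> m <= f' x.
Hypothesis M_gt0 : 0 < M.
Hypothesis f'_lip : forall x y, 0 <= x <= 1 -> 0 <= y <= 1 ->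
  `|f' x - f' y| <= M * `|x - y|.

Local Notation gap x := (`|f x - x|).

Let M_ge0 : 0 <= M.
Proof. exact: ltW. Qed.

Lemma iter01 n x : 0 <= x <= 1 -> 0 <= iter n f x <= 1.
Proof. by move=> x01; elim: n => //= n /f01. Qed.

Lemma gap_le1 x : 0 <= x <= 1 -> gap x <= 1.
Proof. by move=> x01; have := f01 x01; rewrite ler_norml; lra. Qed.

(** Mean value theorem between [x] and [f x]; the point [z] lies within [gap x] of [x], and [f'] is
    [M]-Lipschitz. *)
Lemma orbit_increment x : 0 <= x <= 1 -> exists z, [/\ 0 <= z <= 1,
  f (f x) - f x = f' z * (f x - x) & `|f' z - f' x| <= M * gap x].
Proof.
move=> x01; have [z [z01 zI E]] := MVT01 df x01 (f01 x01).
exists z; split => //; apply: (le_trans (f'_lip z01 x01)).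
apply: ler_wpM2l => //; move: zI.
by case: (leP x (f x)) => ? ?; [rewrite !ger0_norm|rewrite !ler0_norm]; lra.
Qed.

Lemma der_lower_le1 : m <= 1.
Proof. by rewrite -(f'_fix _ f0) ?f'_ge ?lexx ?ler01. Qed.
Let m_le1 := der_lower_le1.

Lemma gap_ratio x : 0 <= x <= 1 ->
  gap (f x) <= gap x * (1 + (`|f' x - 1| + M * gap x) / m) /\
  gap x <= gap (f x) * (1 + (`|f' x - 1| + M * gap x) / m).
Proof.
move=> x01; have [z [z01 -> Hz]] := orbit_increment x01.
have zm := f'_ge z01; have z0 := f'_gt0 z01.
rewrite normrM (gtr0_norm z0).
set e := _ + M * _.
have Dz : `|f' z - 1| <= e.
  rewrite -(subrKA (f' x)).
  by apply: (le_trans (ler_normD _ _)); rewrite addrC lerD2l.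
have e0 : 0 <= e by apply: le_trans Dz.
(* Dividing by [m <= 1] gives one factor for both directions: [f' z <= 1 + e / m], and
   [1 <= f' z + e <= f' z * (1 + e / m)]. *)
have em : e <= e / m by rewrite ler_peMr// invf_ge1// m_le1.
have ez : e <= f' z * (e / m) by rewrite mulrCA ler_peMr// ler_pdivlMr// mul1r.
move: Dz; rewrite ler_distl => /andP[D1 D2]; split.
  by rewrite mulrC ler_wpM2l//; lra.
rewrite (mulrC (f' z)) -mulrA ler_peMr// mulrDr; lra.
Qed.

(** [s] plays the part of the sign of [f x - x]; it persists because each increment is the previous
    one times a positive derivative. *)
Lemma orbit_same_direction x s : 0 <= x <= 1 -> gap x = s * (f x - x) ->
  forall n, gap (iter n f x) = s * (iter n.+1 f x - iter n f x).
Proof.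
move=> x01 H; elim=> //= n IH.
have [z [z01 E _]] := orbit_increment (iter01 n x01).
by rewrite E normrM (gtr0_norm (f'_gt0 z01)) IH mulrCA.
Qed.

(* The orbit is monotone, so the gaps are the lengths of disjoint intervals. *)
Lemma sum_gap_le1 x n : 0 <= x <= 1 -> \sum_(i < n) gap (iter i f x) <= 1.
Proof.
move=> x01; set s := Num.sg (f x - x).
have E := orbit_same_direction x01 (normrEsg _).
have -> : \sum_(i < n) gap (iter i f x) = s * (iter n f x - x).
  elim: n => [|n IH]; first by rewrite big_ord0 subrr mulr0.
  by rewrite big_ord_recr /= IH E -mulrDr addrC addrA subrK.
apply: (le_trans (ler_norm _)); rewrite normrM.
have xn := iter01 n x01.
have A : `|iter n f x - x| <= 1 by rewrite ler_norml; lra.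
have B : `|s| <= 1 by rewrite normr_sg; case: (_ != 0).
by rewrite -[1]mul1r ler_pM.
Qed.

(** * Bounded distortion *)

Definition orbit_der n x : R := \prod_(i < n) f' (iter i f x).

Lemma orbit_der_gt0 n x : 0 <= x <= 1 -> 0 < orbit_der n x.
Proof. by move=> x01; apply: prodr_gt0 => i _; apply/f'_gt0/iter01. Qed.

(** At each step the gap is multiplied by [f' z] and the product by [f' y]; the two differ by a
    factor at most [1 + M / m * gap y], hence at most its exponential. The errors add up in the
    exponent. *)
Lemma distortion_sum x n : 0 <= x <= 1 ->
  let e := expR (M / m * \sum_(i < n) gap (iter i f x)) in
  orbit_der n x * gap x <= gap (iter n f x) * e /\
  gap (iter n f x) <= orbit_der n x * gap x * e.
Proof.
move=> x01; elim: n => [|n /= [IH1 IH2]].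
  by rewrite /orbit_der !big_ord0 mulr0 expR0 !mulr1 mul1r.
rewrite /orbit_der big_ord_recr /= -/(orbit_der n x) big_ord_recr /=.
set y := iter n f x in IH1 IH2 *.
have y01 : 0 <= y <= 1 by exact: iter01.
have [z [z01 E Hz]] := orbit_increment y01.
rewrite E normrM (gtr0_norm (f'_gt0 z01)) mulrDr expRD.
set e := expR _ in IH1 IH2 *; set e' := expR _.
have e_gt0 : 0 < e by exact: expR_gt0.
have e'_ge : 1 + M / m * gap y <= e' by exact: expR_ge1Dx.
have dm t : 0 <= t <= 1 -> M * gap y <= f' t * (M / m * gap y).
  move=> t01; rewrite (_ : f' t * _ = M * gap y * (f' t / m)); last by ring.
  by rewrite ler_peMr ?mulr_ge0// ler_pdivlMr// mul1r f'_ge.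
have dd s t : 0 <= s <= 1 -> 0 <= t <= 1 -> `|f' s - f' t| <= M * gap y ->
    f' s <= f' t * e'.
  move=> s01 t01; rewrite ler_distl => /andP[_ A].
  apply: (le_trans A); apply: le_trans (ler_wpM2l (ltW (f'_gt0 t01)) e'_ge).
  by rewrite mulrDr mulr1 lerD2l dm.
split.
  rewrite mulrAC (_ : f' z * gap y * (e * e') = gap y * e * (f' z * e')); last by ring.
  apply: ler_pM => //; first by rewrite mulr_ge0// ltW// orbit_der_gt0.
  - by rewrite ltW// f'_gt0.
  - by apply: dd => //; rewrite distrC.
rewrite (mulrC (f' z)) (_ : orbit_der n x * f' y * gap x * (e * e') = orbit_der n x * gap x * e * (f' y * e')); last by ring.
by apply: ler_pM => //; [rewrite ltW// f'_gt0|exact: dd].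
Qed.

Lemma distortion x n : 0 <= x <= 1 ->
  orbit_der n x * gap x <= gap (iter n f x) * expR (M / m) /\
  gap (iter n f x) <= orbit_der n x * gap x * expR (M / m).
Proof.
move=> x01; have /= [A B] := distortion_sum n x01.
have E : expR (M / m * \sum_(i < n) gap (iter i f x)) <= expR (M / m).
  by rewrite ler_expR ler_piMr ?sum_gap_le1// divr_ge0// ltW.
split; [apply: (le_trans A)|apply: (le_trans B)]; rewrite ler_wpM2l//.
by rewrite mulr_ge0// ltW// orbit_der_gt0.
Qed.

(** * Derivatives of iterates and the growth sequence in terms of gaps *)

Lemma inv_iter01 n x : 0 <= x <= 1 -> 0 <= iter n (inv01 f) x <= 1.
Proof. by move=> x01; elim: n => //= n /inv_01. Qed.

Lemma iter_invK n x : 0 <= x <= 1 -> iter n f (iter n (inv01 f) x) = x.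
Proof.
move=> x01; elim: n => // n IH; rewrite iterSr /= Kinv//; exact: inv_iter01.
Qed.

Lemma der01_iter n x : 0 <= x <= 1 -> der01 (iter n f) x = orbit_der n x.
Proof.
move=> x01; apply: has_der01_der => //; elim: n => [|n IH].
  rewrite /orbit_der big_ord0 => e e0; exists 1 => // y _ _ /=.
  by rewrite mul1r subrr normr0 mulr_ge0// ltW.
rewrite /orbit_der big_ord_recr /= mulrC.
by apply: (has_der01_comp (iter01 n) IH); exact/df/iter01.
Qed.

(** Evaluated at the end of a forward orbit, so that the same product describes [f] and its
    inverse. *)
Lemma der01_iter_inv n x : 0 <= x <= 1 ->
  der01 (iter n (inv01 f)) (iter n f x) = (orbit_der n x)^-1.
Proof.
move=> x01; apply: has_der01_der; first exact: iter01.
elim: n => [|n IH].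
  rewrite /orbit_der big_ord0 invr1 => e e0; exists 1 => // y _ _ /=.
  by rewrite mul1r subrr normr0 mulr_ge0// ltW.
rewrite /orbit_der big_ord_recr /= invfM.
have -> : iter n.+1 (inv01 f) = iter n (inv01 f) \o inv01 f.
  by apply/funext => y; rewrite iterSr.
apply: has_der01_comp => //; first exact/dinv/iter01.
by rewrite invK//; exact: iter01.
Qed.

Lemma orbit_der_fix n x : 0 <= x <= 1 -> f x = x -> orbit_der n x = 1.
Proof.
move=> x01 fx; apply: big1 => i _.
by rewrite (_ : iter i f x = x) ?f'_fix//; elim: {i}(nat_of_ord i) => //= i ->.
Qed.

(** Crude bounds for fixed [n]: they only ensure that the suprema in [Growth] are taken over bounded
    sets. *)
Lemma orbit_der_bounds n x : 0 <= x <= 1 ->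
  m ^+ n <= orbit_der n x <= (1 + M) ^+ n.
Proof.
move=> x01; rewrite /orbit_der.
have E (c : R) : c ^+ n = \prod_(i < n) c by rewrite prodr_const card_ord.
rewrite !E; apply/andP; split; apply: ler_prod => i _; have y01 := iter01 i x01.
  by rewrite ltW//= f'_ge.
rewrite ltW ?f'_gt0//=.
have := f'_lip y01 zero01; rewrite (f'_fix zero01 f0) subr0 ler_distl => /andP[_ A].
apply: (le_trans A); rewrite lerD2l ler_piMr//.
by rewrite ger0_norm; case/andP: y01.
Qed.

(** By distortion, derivatives of iterates are gap ratios up to [expR (M / m)]. At fixed points the
    gap vanishes, but there the derivative is 1, covered by [1 <= K]. *)
Lemma Growth_le n K : 1 <= K ->
  (forall x, 0 <= x <= 1 -> gap (iter n f x) <= K * gap x /\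
                           gap x <= K * gap (iter n f x)) ->
  Growth f n <= expR (M / m) * K.
Proof.
move=> K1 H.
have D1 : 1 <= expR (M / m) by rewrite -expR0 ler_expR divr_ge0// ltW.
have DK : 1 <= expR (M / m) * K by rewrite -[1]mul1r ler_pM.
rewrite ge_max; apply/andP; split; apply: maxder01_le => x x01.
  rewrite der01_iter// gtr0_norm ?orbit_der_gt0//.
  have [fx|fx] := eqVneq (f x) x; first by rewrite orbit_der_fix.
  have gx : 0 < gap x by rewrite normr_gt0 subr_eq0.
  rewrite -(ler_pM2r gx); apply: (le_trans (distortion n x01).1).
  by rewrite mulrC -mulrA ler_wpM2l ?expR_ge0// (H x x01).1.
rewrite -(iter_invK n x01); have := inv_iter01 n x01.
move: (iter n _ x) => {x x01}x x01.
have P0 := orbit_der_gt0 n x01.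
rewrite der01_iter_inv// gtr0_norm ?invr_gt0//.
have [fx|fx] := eqVneq (f x) x; first by rewrite orbit_der_fix// invr1.
have gx : 0 < gap x by rewrite normr_gt0 subr_eq0.
rewrite -[leLHS]mul1r ler_pdivrMr// -(ler_pM2r gx) mul1r.
apply: (le_trans (H x x01).2).
rewrite (_ : _ * gap x = K * (orbit_der n x * gap x * expR (M / m))); last by ring.
by rewrite ler_wpM2l ?(le_trans ler01)// (distortion n x01).2.
Qed.

Lemma orbit_der_le_Growth n x : 0 <= x <= 1 ->
  orbit_der n x <= Growth f n /\ (orbit_der n x)^-1 <= Growth f n.
Proof.
move=> x01; rewrite !le_max; split; apply/orP; [left|right].
  rewrite -(der01_iter n x01); apply: (le_trans (ler_norm _)).
  apply: (maxder01_ge (K := (1 + M) ^+ n)) => // y y01.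
  rewrite der01_iter// gtr0_norm ?orbit_der_gt0//.
  by case/andP: (orbit_der_bounds n y01).
rewrite -(der01_iter_inv n x01); apply: (le_trans (ler_norm _)).
apply: (maxder01_ge (K := (m ^+ n)^-1)); last exact: iter01.
move=> y y01; rewrite -(iter_invK n y01); have := inv_iter01 n y01.
move: (iter n _ y) => {y y01}y y01; have Q0 := orbit_der_gt0 n y01.
rewrite der01_iter_inv// gtr0_norm ?invr_gt0// lef_pV2 ?posrE ?exprn_gt0//.
by case/andP: (orbit_der_bounds n y01).
Qed.

Lemma Growth_gt0 n : 0 < Growth f n.
Proof. exact: lt_le_trans (orbit_der_gt0 n zero01) (orbit_der_le_Growth n zero01).1. Qed.

(** Converse use of distortion: every gap ratio, in either direction, bounds the growth from
    below. *)
Lemma gap_le_Growth n x : 0 <= x <= 1 ->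
  gap (iter n f x) <= expR (M / m) * gap x * Growth f n /\
  gap x <= expR (M / m) * gap (iter n f x) * Growth f n.
Proof.
move=> x01; have P0 := orbit_der_gt0 n x01.
have [G1 G2] := orbit_der_le_Growth n x01.
have [A B] := distortion n x01; split.
  apply: (le_trans B); rewrite -mulrA mulrC (mulrC (gap x)).
  by rewrite ler_wpM2l// mulr_ge0// expR_ge0.
rewrite -[leLHS](mulKf (lt0r_neq0 P0)) mulrC (mulrC (expR _)).
apply: ler_pM => //; last by rewrite invr_ge0 ltW.
by rewrite mulr_ge0// ltW.
Qed.

(** * Upper bounds for the growth from estimates of [|f' - 1|] *)

(** One step changes the gap by a factor [1 + O(gap^al)], hence its power [- al] by a bounded
    amount. *)
Lemma gap_powRN_step al w x : 0 < al <= 1 -> 0 <= x <= 1 -> f x != x ->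
  `|f' x - 1| + M * gap x <= w * gap x `^ al ->
  `|gap (f x) `^ (- al) - gap x `^ (- al)| <= w / m.
Proof.
move=> al01 x01 fx H.
have a0 : 0 < gap x by rewrite normr_gt0 subr_eq0.
have b0 : 0 < gap (f x).
  have [z [z01 -> _]] := orbit_increment x01.
  by rewrite normrM mulr_gt0// normr_gt0 gt_eqF// f'_gt0.
set a := gap x in a0 H *; set b := gap (f x) in b0 *.
have s0 : 0 < a `^ (- al) by rewrite powR_gt0.
have t0 : 0 < b `^ (- al) by rewrite powR_gt0.
have w0 : 0 <= w.
  rewrite -(pmulr_lge0 _ (powR_gt0 al a0)); apply: le_trans H.
  by rewrite addr_ge0// mulr_ge0// ltW.
have W0 : 0 <= w / m by rewrite divr_ge0// ltW.
(* Chosen so that [a]^ (- al) * (1 + c) = a [^ (- al) + w / m]. *)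
pose c := w / m / a `^ (- al).
have c0 : 0 <= c by rewrite divr_ge0// powR_ge0.
have [B A] : b <= a * (1 + c) /\ a <= b * (1 + c).
  have [B A] := gap_ratio x01.
  have cE : (`|f' x - 1| + M * a) / m <= c.
    by rewrite /c mulrAC ler_pM2r ?invr_gt0// powRN invrK.
  split; [apply: (le_trans B)|apply: (le_trans A)]; rewrite ler_wpM2l//.
    by rewrite lerD2l.
  by rewrite lerD2l.
have {A B}[A B] := (powRN_le_mul1D a0 b0 c0 al01 B, powRN_le_mul1D b0 a0 c0 al01 A).
move: A B; rewrite /c; move: (a `^ _) (b `^ _) (w / m) s0 t0 W0 => s t W s0 t0 W0.
rewrite [s * _]mulrDr mulr1 mulrCA divff ?gt_eqF// mulr1 => A B.
rewrite ler_distl; apply/andP; split; last by [].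
(* This is [A] multiplied by [s]; it would fail if [s] exceeded [t + W]. *)
have : s * s <= t * (s + W).
  have -> : t * (s + W) = t * (1 + W / s) * s by field; rewrite gt_eqF.
  by rewrite ler_pM2r.
nra.
Qed.

Lemma iter_gap_eq0 n x : 0 <= x <= 1 -> (f (iter n f x) == iter n f x) = (f x == x).
Proof.
move=> x01; elim: n => //= n <-; have y01 := iter01 n x01.
have [z [z01 E _]] := orbit_increment y01.
by rewrite -subr_eq0 E mulf_eq0 gt_eqF ?f'_gt0//= subr_eq0.
Qed.

(** The steps of [gap^(-al)] are summed along the orbit. The part [A] costs [A n], while [B * gap]
    costs at most [B] in total, as the gaps sum to at most 1: only [A] governs the rate in [n]. *)
Lemma Growth_le_powR al A B n : 0 < al <= 1 -> 0 <= A -> 0 <= B ->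
  (forall x, 0 <= x <= 1 ->
     `|f' x - 1| + M * gap x <= (A + B * gap x) * gap x `^ al) ->
  Growth f n <= expR (M / m) * (1 + (A * n%:R + B) / m) `^ al^-1.
Proof.
move=> al01 A0 B0 H; have /andP[al0 al1] := al01.
set W := (A * n%:R + B) / m.
have W0 : 0 <= W by rewrite divr_ge0 ?addr_ge0 ?mulr_ge0// ltW.
apply: Growth_le.
  apply: le_trans (_ : (1 + W) `^ 0 <= _); first by rewrite powRr0.
  by apply: ler_powR; rewrite ?invr_ge0 ?lerDl// ltW.
move=> x x01.
have [fx|fx] := eqVneq (f x) x.
  have /eqP fn : f (iter n f x) == iter n f x by rewrite iter_gap_eq0//; apply/eqP.
  by rewrite fx fn !subrr normr0 mulr0.
have fn i : f (iter i f x) != iter i f x by rewrite iter_gap_eq0.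
have g0 i : 0 < gap (iter i f x) by rewrite normr_gt0 subr_eq0.
pose s i := gap (iter i f x) `^ (- al).
have s1 i : 1 <= s i.
  rewrite /s powRN invf_ge1 ?powR_gt0//.
  apply: le_trans (_ : 1 `^ al <= 1); last by rewrite powR1.
  by apply: ge0_ler_powR; rewrite ?nnegrE ?gap_le1 ?iter01// ltW.
have ds : `|s n - s 0| <= W.
  have : `|s n - s 0| <= \sum_(i < n) (A + B * gap (iter i f x)) / m.
    elim: (n) => [|k IH]; first by rewrite subrr normr0 big_ord0.
    rewrite big_ord_recr /= [leRHS]addrC -(subrKA (s k)).
    apply: (le_trans (ler_normD _ _)); rewrite lerD//.
    exact: (gap_powRN_step al01 (iter01 k x01) (fn k) (H _ (iter01 k x01))).
  move/le_trans; apply; rewrite -mulr_suml ler_wpM2r ?invr_ge0 ?(ltW m_gt0)//.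
  rewrite big_split /= sumr_const card_ord mulr_natr lerD2l -mulr_sumr.
  by rewrite ler_piMr// sum_gap_le1.
(* Since [s >= 1], the additive bound [W] becomes the factor [1 + W]. *)
have sW : `|s n - s 0| <= W -> s n <= s 0 * (1 + W) /\ s 0 <= s n * (1 + W).
  rewrite ler_distl => /andP[P Q]; have := s1 n; have := s1 0%N; nra.
have {sW}[P Q] := sW ds; have W1 : 0 <= 1 + W by rewrite addr_ge0.
split; [exact: (le_mul_powRV (g0 0%N) (g0 n) W1 al0 Q)|].
exact: (le_mul_powRV (g0 n) (g0 0%N) W1 al0 P).
Qed.

(** * Estimates of [|f' - 1|] by powers of the gap *)

Let dgap x : 0 <= x <= 1 -> has_der01 (fun y => f y - y) x (f' x - 1).
Proof. by move=> x01; apply: has_der01B; [exact: df|exact: has_der01_id]. Qed.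

Let gap_eq0 x : f x - x = 0 -> f x = x.
Proof. by move/eqP; rewrite subr_eq0 => /eqP. Qed.

(** [sqr_der_le] for [f - id], with the Lipschitz constant written as [c ^+ 2] so that the square
    root is explicit. *)
Lemma der01_le_sqrt_gap c r x : 0 < c -> 0 <= x <= 1 ->
  (forall y, 0 <= y <= 1 -> `|y - x| <= r -> `|f' y - f' x| <= c ^+ 2 * `|y - x|) ->
  `|f' x - 1| <= c ^+ 2 * r -> `|f' x - 1| <= 2 * c * gap x `^ 2^-1.
Proof.
move=> c0 x01 Hl Hr.
have c20 : 0 < c ^+ 2 by rewrite exprn_gt0.
have : (f' x - 1) ^+ 2 <= 4 * c ^+ 2 * gap x.
  apply: (@sqr_der_le _ (fun y => f y - y) (fun y => f' y - 1) _ r) => //.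
  - by rewrite f0 subrr.
  - by rewrite f1 subrr.
  - by move=> y y01 /gap_eq0 /(f'_fix y01)->; rewrite subrr.
  - by move=> y y01 yr; rewrite opprB addrA subrK Hl.
have -> : 4 * c ^+ 2 * gap x = (2 * c * gap x `^ 2^-1) ^+ 2.
  by rewrite exprMn powR_half_sqr//; ring.
rewrite -[X in X <= _ -> _]real_normK ?num_real// => le2.
by rewrite -(@ler_pXn2r _ 2) ?nnegrE ?mulr_ge0 ?powR_ge0 ?(ltW c0).
Qed.

Lemma gap_le_powR al x : al <= 1 -> 0 <= x <= 1 -> gap x <= gap x `^ al.
Proof.
move=> al1 x01; have := gap_le1 x01; have : 0 <= gap x by [].
rewrite le_eqVlt => /predU1P[<-|g0 g1]; first by rewrite powR_ge0.
by apply: ger1_powR; rewrite ?g0.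
Qed.

Lemma der01_dist1_le x : 0 <= x <= 1 -> `|f' x - 1| <= M * x.
Proof.
move=> x01; have := f'_lip x01 zero01; rewrite (f'_fix zero01 f0) subr0.
by case/andP: x01 => x0 _; rewrite (ger0_norm x0).
Qed.

Lemma der01_dist1_leM x : 0 <= x <= 1 -> `|f' x - 1| <= M.
Proof.
move=> x01; apply: (le_trans (der01_dist1_le x01)).
by rewrite ler_piMr//; case/andP: x01.
Qed.

Lemma der01_le_powR_half : exists2 A, 0 <= A &
  forall x, 0 <= x <= 1 -> `|f' x - 1| <= A * gap x `^ 2^-1.
Proof.
have c0 : 0 < Num.sqrt M by rewrite sqrtr_gt0.
exists (2 * Num.sqrt M) => [|x x01]; first by rewrite mulr_ge0// ltW.
apply: (der01_le_sqrt_gap (r := 1)) => //.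
  by move=> y y01 _; rewrite sqr_sqrtr// f'_lip.
by rewrite sqr_sqrtr// mulr1 der01_dist1_leM.
Qed.

(** [M * gap] is absorbed into [gap^al], since gaps are at most 1. *)
Lemma Growth_bigO al A : 0 < al <= 1 -> 0 <= A ->
  (forall x, 0 <= x <= 1 -> `|f' x - 1| <= A * gap x `^ al) ->
  exists C, forall n, (1 <= n)%N -> Growth f n <= C * n%:R `^ al^-1.
Proof.
move=> al01 A0 H; have /andP[al0 al1] := al01.
have AM0 : 0 <= A + M by rewrite addr_ge0.
exists (expR (M / m) * (1 + (A + M) / m) `^ al^-1) => n n1.
apply: (le_trans (Growth_le_powR n al01 AM0 (lexx 0) _)).
  move=> x x01; rewrite mul0r addr0 mulrDl lerD ?H//.
  by rewrite ler_wpM2l// gap_le_powR.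
rewrite -mulrA ler_wpM2l ?expR_ge0// -powRM ?addr_ge0 ?divr_ge0// ?(ltW m_gt0)//.
have n1' : 1 <= n%:R :> R by rewrite ler1n.
have Am : 0 <= (A + M) / m by rewrite divr_ge0// ltW.
apply: ge0_ler_powR; rewrite ?nnegrE ?invr_ge0 ?(ltW al0)//.
- by rewrite addr0 addr_ge0// divr_ge0 ?mulr_ge0// ltW.
- by rewrite mulr_ge0 ?addr_ge0.
- by rewrite addr0 mulrAC [leRHS]mulrDl mul1r lerD2r.
Qed.

(** * Fixed points with vanishing second derivative *)

(** Near [p] the second derivative is small, so [f'] has Lipschitz constant at most [A ^+ 2]
    there. *)
Lemma der01_locally_small p A : 0 <= p <= 1 -> f p = p -> der01n 2 f p = 0 ->
  0 < A -> exists2 r, 0 < r & forall x, 0 <= x <= 1 -> `|x - p| < r ->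
    `|f' x - 1| <= 2 * A * gap x `^ 2^-1.
Proof.
move=> p01 fp fp2 A0; have A20 : 0 < A ^+ 2 by rewrite exprn_gt0.
have [r r0 Hr] := has_der01_cont (Diff01_der 2 p01) A20.
have L y z : 0 <= y <= 1 -> 0 <= z <= 1 -> `|y - p| < r -> `|z - p| < r ->
    `|f' y - f' z| <= A ^+ 2 * `|y - z|.
  move=> y01 z01 yr zr; have [w [w01 wI ->]] := MVT01 (Diff01_der 1) z01 y01.
  rewrite normrM ler_wpM2r//.
  have wr : `|w - p| < r.
    move: wI yr zr; rewrite !ltr_norml.
    by case: (leP z y) => ? /andP[? ?] /andP[? ?] /andP[? ?]; apply/andP; split; lra.
  by have := Hr w w01 wr; rewrite fp2 subr0 => /ltW.
(* Half the radius, so that points within [|x - p|] of [x] remain within [r] of [p]. *)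
exists (r / 2) => [|x x01 xr]; first by rewrite divr_gt0.
have xr' : `|x - p| < r by lra.
apply: (der01_le_sqrt_gap (r := `|x - p|)) => //.
  move=> y y01 yx; apply: L => //.
  by have := ler_distD x y p; lra.
by have := L x p x01 p01 xr'; rewrite subrr normr0 (f'_fix p01 fp); apply.
Qed.

Lemma gap_cont p e : 0 <= p <= 1 -> 0 < e -> exists2 r, 0 < r &
  forall x, 0 <= x <= 1 -> `|x - p| < r -> `|gap x - gap p| < e.
Proof.
move=> p01 e0; have [r r0 Hr] := has_der01_cont (dgap p01) e0.
exists r => // x x01 xr; apply: le_lt_trans (Hr x x01 xr).
exact: ler_dist_dist.
Qed.

Lemma gap_locally_ge p : 0 <= p <= 1 -> f p != p -> exists2 r, 0 < r &
  forall x, 0 <= x <= 1 -> `|x - p| < r -> gap p / 2 <= gap x.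
Proof.
move=> p01 fp; have gp : 0 < gap p / 2 by rewrite divr_gt0// normr_gt0 subr_eq0.
have [r r0 Hr] := gap_cont p01 gp.
by exists r => // x x01 /(Hr x x01); rewrite ltr_distl => /andP[? _]; lra.
Qed.

(** Near a fixed point both terms on the left are small multiples of the square root of the gap;
    elsewhere the gap is bounded below and a large [B] suffices. Compactness unites the two
    cases. *)
Lemma der01_le_small_powR_half A : 0 < A ->
  (forall p, 0 <= p <= 1 -> f p = p -> der01n 2 f p = 0) ->
  exists2 B, 0 < B & forall x, 0 <= x <= 1 ->
    `|f' x - 1| + M * gap x <= (A + B * gap x) * gap x `^ 2^-1.
Proof.
move=> A0 H2.
apply: (@locally_bounded01 R (fun B x =>
  `|f' x - 1| + M * gap x <= (A + B * gap x) * gap x `^ 2^-1)) => p p01.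
have [fp|fp] := eqVneq (f p) p.
  have A4 : 0 < A / 4 by rewrite divr_gt0.
  have [r r0 Hr] := der01_locally_small p01 fp (H2 p p01 fp) A4.
  (* Once the gap is below [e], [M] times its square root is at most [A / 2]. *)
  pose e := (A / (2 * M)) ^+ 2.
  have e0 : 0 < e by rewrite exprn_gt0// divr_gt0// mulr_gt0.
  have [s s0 Hs] := gap_cont p01 e0.
  exists (Num.min r s); first by rewrite lt_min r0.
  exists 0 => x B x01; rewrite lt_min => /andP[/(Hr x x01) D /(Hs x x01)] + B0.
  rewrite fp subrr normr0 subr0 (ger0_norm (normr_ge0 _)) => ge.
  have w0 := powR_ge0 (gap x) 2^-1; have ww := powR_half_sqr (normr_ge0 (f x - x)).
  set w := gap x `^ _ in D w0 ww *.
  have we : w <= A / (2 * M).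
    by rewrite -(@ler_pXn2r _ 2)// ?ww ?nnegrE ?divr_ge0 ?mulr_ge0// ltW.
  have Mw : M * w <= A / 2.
    rewrite (_ : A / 2 = M * (A / (2 * M))) ?ler_wpM2l//.
    by field; rewrite gt_eqF.
  have : M * gap x <= A / 2 * w by rewrite -ww expr2 mulrA ler_wpM2r.
  have : 0 <= B * gap x * w by rewrite !mulr_ge0.
  rewrite mulrDl; lra.
have [r r0 Hr] := gap_locally_ge p01 fp.
have gp : 0 < gap p / 2 by rewrite divr_gt0// normr_gt0 subr_eq0.
set c := gap p / 2 in gp Hr *.
exists r => //; exists (2 * M / (c * c `^ 2^-1)) => x B x01 /(Hr x x01) cg HB.
have cc : 0 < c * c `^ 2^-1 by rewrite mulr_gt0// powR_gt0.
have L : `|f' x - 1| + M * gap x <= 2 * M.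
  rewrite mulrDl mul1r lerD ?der01_dist1_leM// ler_piMr//.
  exact: gap_le1.
apply: (le_trans L); rewrite ler_pdivrMr// in HB; apply: (le_trans HB).
have B0 : 0 <= B.
  by rewrite -(pmulr_lge0 _ cc); apply: le_trans HB; rewrite mulr_ge0.
rewrite mulrDl -(mulrA B); apply: ler_wpDl; first by rewrite mulr_ge0 ?powR_ge0// ltW.
rewrite ler_wpM2l//; apply: ler_pM; rewrite ?powR_ge0// ?(ltW gp)//.
by apply: ge0_ler_powR; rewrite ?nnegrE ?invr_ge0// ltW.
Qed.

Lemma Growth_littleo :
  (forall p, 0 <= p <= 1 -> f p = p -> der01n 2 f p = 0) ->
  Growth f =o_\oo (fun n : nat => n%:R ^+ 2 : R).
Proof.
move=> H2; apply/eqoP => e e0.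
set D := expR (M / m); have D0 : 0 < D by exact: expR_gt0.
(* The final bound is [D * (2 * t * n) ^+ 2]; [t <= 1] and [t <= e / (4 * D)] give
   [4 * D * t ^+ 2 <= e]. *)
pose t := Num.min 1 (e / (4 * D)).
have t0 : 0 < t by rewrite lt_min ltr01 divr_gt0// mulr_gt0.
have t1 : t <= 1 by rewrite ge_min lexx.
have te : t <= e / (4 * D) by rewrite ge_min lexx orbT.
have A0 : 0 < t * m by rewrite mulr_gt0.
have [B B0 HB] := der01_le_small_powR_half A0 H2.
have h01 : 0 < (2^-1 : R) <= 1 by lra.
near=> n.
rewrite gtr0_norm ?Growth_gt0// ger0_norm ?exprn_ge0//.
apply: (le_trans (Growth_le_powR n h01 (ltW A0) (ltW B0) HB)); rewrite invrK.
rewrite -/D; set W := (t * m * _ + B) / m.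
have W0 : 0 <= W by rewrite divr_ge0 ?addr_ge0 ?mulr_ge0// ?(ltW t0)// ?ltW.
rewrite powR_mulrn ?addr_ge0//.
(* With [A = t * m], [W = t * n + B / m]; from this [n] on, [t * n] dominates [1 + B / m]. *)
have nB : (1 + B / m) / t <= n%:R.
  near: n; exact: nbhs_infty_ger.
have W2 : 1 + W <= 2 * t * n%:R.
  rewrite ler_pdivrMr// in nB; rewrite /W mulrDl.
  have -> : t * m * n%:R / m = t * n%:R by field; rewrite gt_eqF.
  lra.
have n0 : 0 <= n%:R :> R by [].
apply: (@le_trans _ _ (D * (2 * t * n%:R) ^+ 2)).
  rewrite ler_pM2l//; apply: lerXn2r => //; rewrite nnegrE ?addr_ge0//.
  by rewrite !mulr_ge0// ltW.
rewrite exprMn mulrA ler_wpM2r ?exprn_ge0//.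
rewrite ler_pdivlMr ?mulr_gt0// in te.
apply: le_trans te; rewrite (_ : D * _ = t * (4 * D) * t); last by ring.
by rewrite ler_piMr// !mulr_ge0// ltW.
Unshelve. all: by end_near.
Qed.

(** * Fixed points of finite order *)

Lemma Ek_gap_bounds q p : (0 < q)%N -> Ek q.+1 f p ->
  exists r c C, [/\ 0 < r, 0 < c, 0 < C & forall x, 0 <= x <= 1 -> `|x - p| < r ->
    [/\ c * `|x - p| ^+ q.+1 <= gap x, gap x <= C * `|x - p| ^+ q.+1
      & `|f' x - 1| <= C * `|x - p| ^+ q]].
Proof.
case: q => // q _ [[p01 fp] fp1 Hj /eqP K0].
(* The successive derivatives of [f - id]: from order 2 on they are those of [f]. *)
pose F j := match j with
  | 0%N => fun y => f y - y | 1%N => fun y => f' y - 1 | _ => der01n j f end.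
have dF j x : 0 <= x <= 1 -> has_der01 (F j) x (F j.+1 x).
  case: j => [|[|j]] x01; [exact: dgap| |exact: Diff01_der].
  by rewrite -[F 2%N x]subr0; apply: has_der01B; [exact: (Diff01_der 1)|exact: has_der01_cst].
have F0 j : (j < q.+2)%N -> F j p = 0.
  case: j => [|[|j]] jq; first by rewrite /= fp subrr.
    by rewrite /= fp1 subrr.
  by apply: Hj; rewrite jq.
set c0 := der01n q.+2 f p / (q.+2)`!%:R.
set c1 := der01n q.+2 f p / (q.+1)`!%:R.
(* A Taylor error of half the leading coefficient keeps the gap comparable to [|x - p| ^+ q.+2] from
   both sides. *)
have c00 : 0 < `|c0| / 2.
  by rewrite divr_gt0// normr_gt0 mulf_neq0// invr_eq0 pnatr_eq0 -lt0n fact_gt0.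
have [r r0 Hr] := taylor01 p01 dF F0 c00.
have [s s0 Hs] := @taylor01 _ q.+1 (fun j => F j.+1) p p01 (fun j => @dF j.+1)
  (fun j => F0 j.+1) 1 ltr01.
exists (Num.min r s), (`|c0| / 2), (2 * `|c0| + `|c1| + 1); split=> //.
- by rewrite lt_min r0.
- by rewrite ltr_wpDl// addr_ge0// mulr_ge0.
move=> x x01; rewrite lt_min => /andP[/(Hr x x01) A /(Hs x x01)].
rewrite [F 1%N]/= [F q.+2]/= -/c1 => B.
rewrite [F 0%N]/= [F q.+2]/= -/c0 in A.
set u := `|x - p| in A B *.
have u0 n : 0 <= u ^+ n by apply: exprn_ge0; exact: normr_ge0.
have N0 : `|c0 * (x - p) ^+ q.+2| = `|c0| * u ^+ q.+2 by rewrite normrM normrX.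
have N1 : `|c1 * (x - p) ^+ q.+1| = `|c1| * u ^+ q.+1 by rewrite normrM normrX.
have e1 : 0 <= (`|c1| + 1) * u ^+ q.+2 by rewrite mulr_ge0// addr_ge0.
have e2 : 0 <= 2 * `|c0| * u ^+ q.+1 by rewrite !mulr_ge0.
have e3 : 0 <= `|c0| * u ^+ q.+2 by rewrite mulr_ge0.
split.
- have := ler_distD 0 (c0 * (x - p) ^+ q.+2) (f x - x).
  have := lerB_dist (c0 * (x - p) ^+ q.+2) (f x - x).
  rewrite N0 distrC => L _; move: (le_trans L A); lra.
- have := lerB_dist (f x - x) (c0 * (x - p) ^+ q.+2).
  rewrite N0 => L; move: (le_trans L A); lra.
have := lerB_dist (f' x - 1) (c1 * (x - p) ^+ q.+1).
rewrite N1 => L; move: (le_trans L B); lra.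
Qed.

(** Near a point of order [q + 1], [|f' - 1|] is at most of order [|x - p|^q], hence of order
    [gap^(q/(q+1))]. As gaps are at most 1 and [k <= q], the exponent may be lowered to
    [k/(k+1)]. *)
Lemma der01_le_powR_Ek k : (0 < k)%N ->
  (forall p, 0 <= p <= 1 -> f p = p -> exists2 q, (k <= q)%N & Ek q.+1 f p) ->
  exists2 A, 0 < A & forall x, 0 <= x <= 1 ->
    `|f' x - 1| <= A * gap x `^ (k%:R / k.+1%:R).
Proof.
move=> k0 HE; set al : R := _ / _.
have al01 : 0 < al <= 1 by exact: natr_ratio_01.
have /andP[al0 al1] := al01.
apply: (@locally_bounded01 R (fun A x =>
  `|f' x - 1| <= A * gap x `^ al)) => p p01.
have [fp|fp] := eqVneq (f p) p; last first.
  have [r r0 Hr] := gap_locally_ge p01 fp.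
  have gp : 0 < gap p / 2 by rewrite divr_gt0// normr_gt0 subr_eq0.
  exists r => //; exists (M / (gap p / 2) `^ al) => x A x01 /(Hr x x01) cg.
  rewrite ler_pdivrMr ?powR_gt0// => HA.
  apply: (le_trans (der01_dist1_leM x01)); apply: (le_trans HA).
  have A0 : 0 <= A by rewrite -(pmulr_lge0 _ (powR_gt0 al gp)); apply: le_trans HA.
  rewrite ler_wpM2l//; apply: ge0_ler_powR => //; rewrite ?nnegrE ?(ltW al0) ?(ltW gp)//.
have [q kq Eq] := HE p p01 fp; have q0 : (0 < q)%N by exact: leq_trans kq.
have [r [c [C [r0 c0 C0 Hr]]]] := Ek_gap_bounds q0 Eq.
pose be : R := q%:R / q.+1%:R.
have /andP[be0 be1] : 0 < be <= 1 by exact: natr_ratio_01.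
have ab : al <= be by apply: natr_ratio_le; rewrite k0.
exists r => //; exists (C / c `^ be) => x A x01 /(Hr x x01)[H1 _ H2] HA.
have gb : (c * `|x - p| ^+ q.+1) `^ be <= gap x `^ be.
  by apply: ge0_ler_powR => //; rewrite ?nnegrE ?(ltW be0) ?mulr_ge0 ?exprn_ge0 ?(ltW c0).
have E : (c * `|x - p| ^+ q.+1) `^ be = c `^ be * `|x - p| ^+ q.
  rewrite powRM ?exprn_ge0 ?(ltW c0)//; congr (_ * _).
  rewrite -powR_mulrn// -powRrM -[RHS]powR_mulrn//; congr (_ `^ _).
  by rewrite /be mulrC divfK// pnatr_eq0.
have gal : gap x `^ be <= gap x `^ al.
  have := gap_le1 x01; have : 0 <= gap x by [].
  rewrite le_eqVlt => /predU1P[<- _|g0 g1]; first by rewrite !powR0 ?gt_eqF.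
  by apply: ger_powR; rewrite ?g0.
apply: (le_trans H2); rewrite E in gb.
have cb : 0 < c `^ be by exact: powR_gt0.
apply: le_trans (_ : C / c `^ be * (c `^ be * `|x - p| ^+ q) <= _).
  by rewrite mulrA divfK// gt_eqF.
apply: ler_pM => //; first by rewrite divr_ge0// ltW.
  by rewrite mulr_ge0 ?exprn_ge0// ltW.
exact: le_trans gb gal.
Qed.

(** * Lower bound from an orbit converging to a fixed point *)

(** The secant slope [b] decides the dynamics: [f] moves [x] towards [p] if [b < 1] and away from it
    if [b > 1]. *)
Lemma der01_secant x p : 0 <= x <= 1 -> 0 <= p <= 1 -> f p = p ->
  exists2 b, 0 < b <= 1 + M & f x - p = b * (x - p).
Proof.
move=> x01 p01 fp; have [z [z01 _ E]] := MVT01 df p01 x01.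
exists (f' z); last by rewrite -E fp.
rewrite f'_gt0//=; have := der01_dist1_leM z01.
by rewrite ler_distl => /andP[_ ?]; lra.
Qed.

Lemma gap_secant x p b : f x - p = b * (x - p) -> gap x = `|b - 1| * `|x - p|.
Proof. by move=> E; rewrite -normrM mulrBl -E mul1r opprB addrA subrK. Qed.

Lemma attracted_step x p b : 0 <= x <= 1 -> 0 <= p <= 1 -> f p = p ->
  x != p -> b < 1 -> f x - p = b * (x - p) ->
  [/\ f x != p, `|f x - p| = `|x - p| - gap x
    & exists2 b', b' < 1 & f (f x) - p = b' * (f x - p)].
Proof.
move=> x01 p01 fp xp b1 E.
have xp0 : x - p != 0 by rewrite subr_eq0.
have [c /andP[c0 _] Ec] := der01_secant x01 p01 fp.
have cb : c = b by apply: (mulIf xp0); rewrite -Ec.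
rewrite {}cb {Ec} in c0.
have fxp : f x - p != 0 by rewrite E mulf_neq0// gt_eqF.
split; first by rewrite -subr_eq0.
  rewrite (gap_secant E) E normrM (gtr0_norm c0) (ltr0_norm (x := b - 1)) ?subr_lt0//; ring.
have [z [z01 Ez _]] := orbit_increment x01; have z0 := f'_gt0 z01.
(* Obtained by dividing [f (f x) - p = f' z * (f x - x) + (f x - p)] by [f x - p = b * (x - p)]. *)
exists (1 - f' z * (1 - b) / b).
  by rewrite gtrBl divr_gt0// mulr_gt0// subr_gt0.
have -> : f (f x) - p = f (f x) - f x + (f x - p) by ring.
rewrite Ez (_ : f x - x = (f x - p) - (x - p)); last by ring.
by rewrite E; field; rewrite gt_eqF.
Qed.

(** Mirror of [attracted_step] for the inverse map. The decrement is the gap at the new point [y],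
    so a comparison of [|x - p|] with [|y - p|] is needed as well. *)
Lemma repelled_step x p b : 0 <= x <= 1 -> 0 <= p <= 1 -> f p = p ->
  x != p -> 1 < b -> f x - p = b * (x - p) -> let y := inv01 f x in
  [/\ y != p, `|y - p| = `|x - p| - gap y, `|x - p| <= (1 + M) * `|y - p|
    & exists2 b', 1 < b' & f y - p = b' * (y - p)].
Proof.
move=> x01 p01 fp xp b1 E y.
have y01 : 0 <= y <= 1 by exact: inv_01.
have fy : f y = x by exact: Kinv.
have xp0 : x - p != 0 by rewrite subr_eq0.
have [c /andP[c0 cM] Ec] := der01_secant y01 p01 fp.
have [z [z01 Ez _]] := orbit_increment y01; have z0 := f'_gt0 z01.
rewrite fy in Ec Ez.
have yp0 : y - p != 0 by apply: contraNneq xp0 => yp; rewrite Ec yp mulr0.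
have c1 : 1 < c.
  (* Both sides, times [y - p], equal [f x - x]; so the slope at [y] exceeds 1 when the slope at [x]
     does. *)
  have F : (b - 1) * c = f' z * (c - 1).
    apply: (mulIf yp0); rewrite -mulrA -Ec mulrBl mul1r -E.
    have -> : f x - p - (x - p) = f x - x by ring.
    rewrite Ez -mulrA mulrBl -Ec mul1r; congr (_ * _); ring.
  have : 0 < f' z * (c - 1) by rewrite -F mulr_gt0// subr_gt0.
  by rewrite pmulr_rgt0// subr_gt0.
have Ey : f y - p = c * (y - p) by rewrite fy.
split; first by rewrite -subr_eq0.
- rewrite (gap_secant Ey) Ec normrM (gtr0_norm c0) (gtr0_norm (x := c - 1)) ?subr_gt0//; ring.
- by rewrite Ec normrM (gtr0_norm c0) ler_wpM2r.
- by exists c.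
Qed.

(** The recursion makes [u n ^+ q.+1] of order at most [n^(-(q+1)/q)], while [G] stays fixed; the
    growth must compensate. *)
Lemma Growth_ge_of_decay (u : nat -> R) q c K G : (0 < q)%N -> 0 < c -> 0 < K ->
  0 < G -> (forall n, 0 < u n) ->
  (forall n, u n.+1 <= u n - c * u n ^+ q.+1) ->
  (forall n, G <= K * u n ^+ q.+1 * Growth f n) ->
  exists2 d, 0 < d & forall n, d * n%:R `^ (q.+1%:R / q%:R) <= Growth f n.
Proof.
move=> q0 c0 K0 G0 u0 Hu HG; set be : R := _ / _.
exists (G / K * c `^ be) => [|n]; first by rewrite mulr_gt0 ?divr_gt0 ?powR_gt0.
have D := sequence_decay q0 c0 u0 Hu n.
have cn0 : 0 <= c * n%:R by rewrite mulr_ge0// ltW.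
have {}D := powR_mulSn_le1 q0 cn0 (ltW (u0 n)) D.
rewrite -/be in D.
rewrite -mulrA -powRM ?(ltW c0)// mulrAC ler_pdivrMr// mulrC.
set X := (_ `^ be) in D *.
have X0 : 0 <= X by exact: powR_ge0.
apply: le_trans (ler_wpM2l X0 (HG n)) _.
have -> : X * (K * u n ^+ q.+1 * Growth f n) =
  (X * u n ^+ q.+1) * (Growth f n * K) by ring.
by rewrite ler_piMl// mulr_ge0 ?ltW ?Growth_gt0.
Qed.

Lemma Growth_ge_Ek q : (0 < q)%N -> Ek q.+1 f !=set0 ->
  exists2 d, 0 < d & forall n, d * n%:R `^ (q.+1%:R / q%:R) <= Growth f n.
Proof.
move=> q0 [p Ep]; have [[p01 fp] _ _ _] := Ep.
have [r [c [C [r0 c0 C0 Hr]]]] := Ek_gap_bounds q0 Ep.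
have [x0 [x01 xp xr]] : exists x, [/\ 0 <= x <= 1, x != p & `|x - p| < r].
  have ? := within01_dnbhs_proper p01.
  apply: (@filter_ex _ (within `[0, 1] p^') _
    [set x | [/\ 0 <= x <= 1, x != p & `|x - p| < r]]).
  by apply/within01_dnbhsP; exists r => // y.
have [b /andP[b0 bM] Eb] := der01_secant x01 p01 fp.
have up : 0 < `|x0 - p| by rewrite normr_gt0 subr_eq0.
have G0 : 0 < gap x0.
  have [L _ _] := Hr x0 x01 xr; apply: lt_le_trans L.
  by rewrite mulr_gt0// exprn_gt0.
have D0 : 0 < expR (M / m) by exact: expR_gt0.
have DC0 : 0 < expR (M / m) * C by rewrite mulr_gt0.
(* Slope 1 would make [x0] fixed, against its positive gap; for [b > 1] the inverse orbit converges
   to [p], for [b < 1] the forward one. *)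
have [b1|b1|b1] := ltgtP b 1; last first.
- by move: G0; rewrite (gap_secant Eb) b1 subrr normr0 mul0r ltxx.
- pose y n := iter n (inv01 f) x0; pose u n := `|y n - p|.
  have Hy n : [/\ 0 <= y n <= 1, y n != p, `|y n - p| < r
      & exists2 b', 1 < b' & f (y n) - p = b' * (y n - p)].
    elim: n => [|n [y01 yp yr [b' b'1 E]]]; first by split=> //; exists b.
    have [A B _ D] := repelled_step y01 p01 fp yp b'1 E.
    split=> //; first exact: inv_01.
    by rewrite /y /= B; apply: le_lt_trans yr; rewrite gerBl.
  have u0 n : 0 < u n by have [_ ? _ _] := Hy n; rewrite normr_gt0 subr_eq0.
  have M1 : 0 < 1 + M by rewrite addr_gt0.
  (* The factor [(1 + M) ^+ q.+1] pays for replacing [u n.+1] by [u n] in the decrement. *)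
  apply: (@Growth_ge_of_decay u q (c / (1 + M) ^+ q.+1) (expR (M / m) * C) (gap x0))
    => // [|n|n].
  + by rewrite divr_gt0// exprn_gt0.
  + have [y01 yp yr [b' b'1 E]] := Hy n.
    have [_ B L _] := repelled_step y01 p01 fp yp b'1 E.
    have [y'01 _ y'r _] := Hy n.+1.
    have [L' _ _] := Hr _ y'01 y'r.
    rewrite [u n.+1]B lerD2l lerN2; apply: le_trans L'.
    rewrite -mulrA ler_wpM2l ?(ltW c0)// ler_pdivrMl ?exprn_gt0// -exprMn.
    by apply: lerXn2r => //; rewrite nnegrE ?mulr_ge0// ltW.
  + have [y01 _ yr _] := Hy n.
    have [_ L _] := Hr _ y01 yr.
    have := (gap_le_Growth n y01).1; rewrite iter_invK// => /le_trans; apply.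
    by rewrite ler_wpM2r ?(ltW (Growth_gt0 n))// -mulrA ler_wpM2l// ltW.
- pose y n := iter n f x0; pose u n := `|y n - p|.
  have Hy n : [/\ 0 <= y n <= 1, y n != p, `|y n - p| < r
      & exists2 b', b' < 1 & f (y n) - p = b' * (y n - p)].
    elim: n => [|n [y01 yp yr [b' b'1 E]]]; first by split=> //; exists b.
    have [A B D] := attracted_step y01 p01 fp yp b'1 E.
    split=> //; first exact: f01.
    by rewrite /y /= B; apply: le_lt_trans yr; rewrite gerBl.
  have u0 n : 0 < u n by have [_ ? _ _] := Hy n; rewrite normr_gt0 subr_eq0.
  apply: (@Growth_ge_of_decay u q c (expR (M / m) * C) (gap x0)) => // n.
  + have [y01 yp yr [b' b'1 E]] := Hy n.
    have [_ B _] := attracted_step y01 p01 fp yp b'1 E.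
    have [L _ _] := Hr _ y01 yr.
    by rewrite [u n.+1]B lerD2l lerN2.
  + have [y01 _ yr _] := Hy n.
    have [_ L _] := Hr _ y01 yr.
    apply: (le_trans (gap_le_Growth n x01).2).
    by rewrite ler_wpM2r ?(ltW (Growth_gt0 n))// -mulrA ler_wpM2l// ltW.
Qed.

End ParabolicDiffeo.

(** * Orders of fixed points and the three cases *)

(** The order of [p] is the least [j >= 2] with a nonzero derivative, which exists outside [Einf].
    Indices are shifted by one, [k] being the least order of vanishing of [f' - 1]. *)
Lemma Ek_of_fixpoint (R : realType) (f : R -> R) k p : E1 f = set0 -> Einf f = set0 ->
  (forall s, (1 < s < k.+1)%N -> Ek s f = set0) ->
  0 <= p <= 1 -> f p = p -> exists2 q, (k <= q)%N & Ek q.+1 f p.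
Proof.
move=> h1 hinf hs p01 fp.
have fp1 : der01 f p = 1.
  by apply: contrapT => nE; have : E1 f p by []; rewrite h1.
have ex : exists j, (2 <= j)%N && (der01n j f p != 0).
  apply: contrapT => nex; have : Einf f p; last by rewrite hinf.
  split=> // j j2; apply: contrapT => /eqP nj; apply: nex.
  by exists j; rewrite j2.
case: (ex_minnP ex) => -[//|q] /andP[q2 /eqP qn] qmin.
have Eq : Ek q.+1 f p.
  split=> // j /andP[j2 jq]; apply: contrapT => /eqP nj.
  by move: (qmin j); rewrite j2 nj => /(_ isT); rewrite leqNgt jq.
exists q => //; rewrite leqNgt; apply/negP => qk.
by have := hs q.+1; rewrite q2 ltnS qk => /(_ isT) Es; move: Eq; rewrite Es.
Qed.

Lemma asymp_intro (R : realType) (a b : nat -> R) (d C : R) : 0 < d ->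
  (forall n, (1 <= n)%N -> [/\ 0 < b n, d * b n <= a n & a n <= C * b n]) ->
  asymp a b.
Proof.
move=> d0 H; exists d, C; split=> // n n1; have [b0 A B] := H n n1.
by rewrite ler_pdivlMr// ler_pdivrMr.
Qed.

Unset Implicit Arguments.

Theorem theorem1 (R : realType) (f : R -> R)
    (hf : Diff01 f) (hE1 : E1 f = set0) :
  [/\ (* (A) *)
      Ek 2 f !=set0 -> asymp (Growth f) (fun n : nat => n%:R ^+ 2),
      (* (B) *)
      Ek 2 f = set0 -> Einf f !=set0 ->
        Growth f =o_\oo (fun n : nat => n%:R ^+ 2 : R)
    & (* (C) *)
      forall k : nat, (3 <= k)%N ->
        (forall s : nat, (1 < s < k)%N -> Ek s f = set0) ->
        Einf f = set0 -> Ek k f !=set0 ->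
        asymp (Growth f) (fun n : nat => n%:R `^ (k%:R / (k%:R - 1)))].
Proof.
have [m m0 Hm] := der01_ge hf hE1.
have [M M0 HM] := der01_lipschitz hf.
split=> [E2|E2 _|[//|q] q2 Es Einf0 Eq].
(* Upper exponent [1 / al] with [al = 1/2] and lower exponent [(q + 1) / q] with [q = 1] are both
   2. *)
- have [A A0 HA] := der01_le_powR_half hf hE1 M0 HM.
  have h01 : 0 < (2^-1 : R) <= 1 by lra.
  have [C HC] := Growth_bigO hf hE1 m0 Hm M0 HM h01 A0 HA.
  have [d d0 Hd] := Growth_ge_Ek hf hE1 m0 Hm M0 HM (q := 1) isT E2.
  apply: (asymp_intro (C := C) d0) => n n1.
  have := HC n n1; have := Hd n; rewrite invrK divr1 !powR_mulrn// => A1 A2.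
  by split=> //; rewrite exprn_gt0// ltr0n.
- apply: (Growth_littleo hf hE1 m0 Hm M0 HM) => p p01 fp.
  apply: contrapT => n2; suff : Ek 2 f p by rewrite E2.
  split=> //; last by case=> [|[|[|j]]].
  by apply: contrapT => nE; have : E1 f p by []; rewrite hE1.
(* Here the order is [q.+1], so [al = q / (q + 1)] and both bounds have exponent [(q + 1) / q]. *)
have q0 : (0 < q)%N by case: q q2 {Es Eq}.
have HE p : 0 <= p <= 1 -> f p = p -> exists2 j, (q <= j)%N & Ek j.+1 f p.
  exact: Ek_of_fixpoint.
have [A A0 HA] := der01_le_powR_Ek hf hE1 M0 HM q0 HE.
have al01 := natr_ratio_01 (R := R) q0.
have [C HC] := Growth_bigO hf hE1 m0 Hm M0 HM al01 (ltW A0) HA.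
have [d d0 Hd] := Growth_ge_Ek hf hE1 m0 Hm M0 HM q0 Eq.
have -> : q.+1%:R - 1 = q%:R :> R by rewrite -natr1 addrK.
rewrite invf_div in HC.
by apply: (asymp_intro (C := C) d0) => n n1; rewrite powR_gt0 ?ltr0n//; split; auto.
Qed.
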